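(* Let $m,\ell$ be two positive integers. If $m=1$ or $\ell=1$, then $G(m,\ell)\simeq\mathbb{Z}$ is abelian. If $m=\ell=2$, then $G(m,\ell)\simeq\mathbb{Z}^2$ is abelian. Otherwise, the center $Z(G(m,\ell))$ is infinite cyclic and generated by $\Delta^{\frac{m}{\gcd(m,\ell)}}$.
   Context: For positive integers $m,\ell$, consider letters $a_0,\ldots,a_{m-1}$, and set $a_j:=a_{j'}$ for $j\in\mathbb{Z}$, where $j'\in\{0,\ldots,m-1\}$ and $j\equiv j' \pmod m$. For $i\in\mathbb{Z}$ and $p\geq 1$ let $s(i,p)=a_ia_{i+1}\cdots a_{i+p-1}$ (a product of $p$ consecutive letters). The circular group $G(m,\ell)$ is the group with generators $a_0,\ldots,a_{m-1}$ and relations $s(i,\ell)=s(i+1,\ell)$ for all $i\in\{0,\ldots,m-1\}$. The Garside element is $\Delta:=s(0,\ell)$, which equals $s(i,\ell)$ for every $i$ in $G(m,\ell)$. *)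

(* Defs.v *)
From HB Require Import structures.
From mathcomp Require Import all_boot all_order all_algebra.
From mathcomp Require Import boolp classical_sets cardinality.

Set Implicit Arguments.
Unset Strict Implicit.
Unset Printing Implicit Defensive.

Local Open Scope quotient_scope.
Local Open Scope group_scope.

(* A word over S is a finite product of generators and formal inverses:       *)
(* (x, true) stands for x and (x, false) for x^-1.                            *)
Definition word (S : Type) := seq (S * bool).

Definition posword (S : Type) (s : seq S) : word S := [seq (x, true) | x <- s].

(* The smallest congruence on words containing the cancellations              *)
(* x x^-1 = 1 = x^-1 x and the pairs related by R.                            *)
Inductive pres_eq (S : Type) (R : word S -> word S -> Prop) :
    word S -> word S -> Prop :=
| PresRel u v : R u v -> pres_eq R u v
| PresCancel x b : pres_eq R [:: (x, b); (x, ~~ b)] [::]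
| PresRefl u : pres_eq R u u
| PresSym u v : pres_eq R u v -> pres_eq R v u
| PresTrans u v w : pres_eq R u v -> pres_eq R v w -> pres_eq R u w
| PresCat u u' v v' :
    pres_eq R u u' -> pres_eq R v v' -> pres_eq R (u ++ v) (u' ++ v').

Section Presentation.
Variables (S : choiceType) (R : word S -> word S -> Prop).

Definition pres_eqb (u v : word S) : bool := `[< pres_eq R u v >].

Lemma pres_eqb_refl : reflexive pres_eqb.
Proof. by move=> u; apply/asboolP; apply: PresRefl. Qed.

Lemma pres_eqb_sym : symmetric pres_eqb.
Proof. by move=> u v; apply/asboolP/asboolP; apply: PresSym. Qed.

Lemma pres_eqb_trans : transitive pres_eqb.
Proof.
by move=> v u w /asboolP uv /asboolP vw; apply/asboolP; apply: PresTrans uv vw.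
Qed.

Canonical pres_equiv :=
  EquivRel pres_eqb pres_eqb_refl pres_eqb_sym pres_eqb_trans.

(* The group < S | u = v for all u, v such that R u v >.                      *)
Definition pres_group := {eq_quot pres_equiv}.

HB.instance Definition _ := Choice.copy pres_group {eq_quot pres_equiv}.

Definition pres_class (u : word S) : pres_group := \pi_{eq_quot pres_equiv} u.

Definition pres_gen (x : S) : pres_group := pres_class [:: (x, true)].

Lemma pres_classP u v : pres_class u = pres_class v <-> pres_eq R u v.
Proof.
split; first by move=> /eqmodP /asboolP.
by move=> uv; apply/eqmodP; apply/asboolP.
Qed.

Lemma pres_classK (x : pres_group) : pres_class (repr x) = x.
Proof. exact: reprK. Qed.

Definition word_inv (u : word S) : word S := rev [seq (p.1, ~~ p.2) | p <- u].

Lemma word_invK : involutive word_inv.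
Proof.
move=> u; rewrite /word_inv map_rev revK -map_comp -[RHS]map_id.
by apply: eq_map => -[x b] /=; rewrite negbK.
Qed.

Lemma word_inv_cat u v : word_inv (u ++ v) = word_inv v ++ word_inv u.
Proof. by rewrite /word_inv map_cat rev_cat. Qed.

Lemma pres_eq_mulV u : pres_eq R (u ++ word_inv u) [::].
Proof.
elim: u => [|[x b] u IHu]; first exact: PresRefl.
rewrite -cat1s word_inv_cat -catA (catA u).
apply: PresTrans (PresCancel R x b).
rewrite -[X in pres_eq _ _ X]cat1s; apply: PresCat; first exact: PresRefl.
rewrite -[X in pres_eq _ _ X]cat0s.
by apply: PresCat IHu _; apply: PresRefl.
Qed.

Lemma pres_eq_mulVl u : pres_eq R (word_inv u ++ u) [::].
Proof. by have := pres_eq_mulV (word_inv u); rewrite word_invK. Qed.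

Lemma pres_eq_inv u v : pres_eq R u v -> pres_eq R (word_inv u) (word_inv v).
Proof.
move=> uv; rewrite -[X in pres_eq _ X _]cats0.
apply: (@PresTrans _ _ _ (word_inv u ++ (v ++ word_inv v))).
  by apply: PresCat; [exact: PresRefl | apply/PresSym/pres_eq_mulV].
rewrite catA -[X in pres_eq _ _ X]cat0s.
apply: PresCat; last exact: PresRefl.
apply: PresTrans (pres_eq_mulVl u).
by apply: PresCat; [exact: PresRefl | exact: PresSym].
Qed.

Definition pres_one : pres_group := pres_class [::].
Definition pres_mul (x y : pres_group) : pres_group :=
  pres_class (repr x ++ repr y).
Definition pres_inv (x : pres_group) : pres_group :=
  pres_class (word_inv (repr x)).

Lemma pres_eq_repr u : pres_eq R (repr (pres_class u)) u.
Proof. by apply/pres_classP; rewrite pres_classK. Qed.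

Lemma pres_mul_class u v :
  pres_mul (pres_class u) (pres_class v) = pres_class (u ++ v).
Proof. by apply/pres_classP; apply: PresCat; exact: pres_eq_repr. Qed.

Lemma pres_inv_class u : pres_inv (pres_class u) = pres_class (word_inv u).
Proof. by apply/pres_classP/pres_eq_inv/pres_eq_repr. Qed.

Fact pres_mulA : associative pres_mul.
Proof.
move=> x y z; rewrite -(pres_classK x) -(pres_classK y) -(pres_classK z).
by rewrite !pres_mul_class catA.
Qed.

Fact pres_mul1 : left_id pres_one pres_mul.
Proof. by move=> x; rewrite -(pres_classK x) pres_mul_class. Qed.

Fact pres_mulr1 : right_id pres_one pres_mul.
Proof. by move=> x; rewrite -(pres_classK x) pres_mul_class cats0. Qed.

Fact pres_mulV : left_inverse pres_one pres_inv pres_mul.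
Proof.
move=> x; rewrite -(pres_classK x) pres_inv_class pres_mul_class.
exact/pres_classP/pres_eq_mulVl.
Qed.

Fact pres_mulrV : right_inverse pres_one pres_inv pres_mul.
Proof.
move=> x; rewrite -(pres_classK x) pres_inv_class pres_mul_class.
exact/pres_classP/pres_eq_mulV.
Qed.

HB.instance Definition _ := isGroup.Build pres_group
  pres_mulA pres_mul1 pres_mulr1 pres_mulV pres_mulrV.

Lemma pres_class_nil : pres_class [::] = 1.
Proof. by []. Qed.

Lemma pres_class_cat u v : pres_class (u ++ v) = pres_class u * pres_class v.
Proof. by rewrite -pres_mul_class. Qed.

Lemma pres_classV u : pres_class (word_inv u) = (pres_class u)^-1.
Proof. by rewrite -pres_inv_class. Qed.

Lemma pres_class_pos (s : seq S) :
  pres_class (posword s) = \prod_(x <- s) pres_gen x.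
Proof.
elim: s => [|x s IHs]; first by rewrite big_nil.
by rewrite big_cons -IHs -pres_class_cat.
Qed.

Definition word_eval (H : groupType) (f : S -> H) (u : word S) : H :=
  \prod_(p <- u) (if p.2 then f p.1 else (f p.1)^-1).

Lemma word_eval_cat (H : groupType) (f : S -> H) u v :
  word_eval f (u ++ v) = word_eval f u * word_eval f v.
Proof. exact: big_cat. Qed.

Lemma word_eval_pres_eq (H : groupType) (f : S -> H) :
  (forall u v, R u v -> word_eval f u = word_eval f v) ->
  forall u v, pres_eq R u v -> word_eval f u = word_eval f v.
Proof.
move=> fR u v; elim=> {u v} //.
- by move=> x [] /=; rewrite /word_eval !big_cons big_nil /= mulg1
    ?mulgV ?mulVg.
- by move=> u v w _ -> _ ->.
- by move=> u u' v v' _ e _ e'; rewrite !word_eval_cat e e'.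
Qed.

Lemma pres_universal (H : groupType) (f : S -> H) :
  (forall u v, R u v -> word_eval f u = word_eval f v) ->
  exists! F : pres_group -> H,
    {morph F : x y / x * y} /\ (forall x, F (pres_gen x) = f x).
Proof.
move=> fR; pose F (x : pres_group) := word_eval f (repr x).
have FE u : F (pres_class u) = word_eval f u.
  exact: word_eval_pres_eq fR _ _ (pres_eq_repr u).
have FM : {morph F : x y / x * y}.
  move=> x y; rewrite -(pres_classK x) -(pres_classK y) -pres_class_cat.
  by rewrite !FE word_eval_cat.
exists F; split; first split=> // x.
  by rewrite FE /word_eval big_seq1.
move=> F' [F'M F'g]; apply: funext => x; rewrite -(pres_classK x) FE.
have F'1 : F' 1 = 1 by apply: (mulIg (F' 1)); rewrite -F'M !mul1g.
have F'V y : F' y^-1 = (F' y)^-1.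
  by apply: (mulIg (F' y)); rewrite -F'M !mulVg.
elim: (repr x) => [|[y b] u IHu]; first by rewrite F'1 /word_eval big_nil.
rewrite -cat1s word_eval_cat IHu pres_class_cat F'M; congr (_ * _).
rewrite /word_eval big_seq1; case: b => /=; rewrite -F'g //.
by rewrite -F'V -pres_classV.
Qed.

End Presentation.

Definition isomorphic (G H : groupType) : Prop :=
  exists f : {multiplicative G -> H}, bijective f.

Definition is_abelian (G : groupType) : Prop := forall x y : G, commute x y.

Definition group_center (G : groupType) : set G :=
  [set z | forall x, commute z x]%classic.
Arguments group_center : clear implicits.

Definition cyclic_subgroup (G : groupType) (g : G) : set G :=
  [set x | exists n : nat, x = g ^+ n \/ x = g ^- n]%classic.

Definition infinite_cyclic_generated_by (G : groupType) (A : set G) (g : G) :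
    Prop :=
  A = cyclic_subgroup g /\ infinite_set A.

(* The additive groups Z and Z^2, written multiplicatively.                   *)
Definition Zgroup : groupType := Algebra.to_multiplicative int.
Definition Z2group : groupType := Algebra.to_multiplicative (int * int)%type.

Section CircularGroup.
Variables (m : nat) (hm : (0 < m)%N).

Fact letter_subproof (j : int) : (`|(j %% m%:Z)%Z|%N < m)%N.
Proof.
by rewrite -ltz_nat gez0_abs ?modz_ge0 ?ltz_mod //; case: m hm.
Qed.

(* The index j' in {0, ..., m-1} congruent to j modulo m.                     *)
Definition letter (j : int) : 'I_m := Ordinal (letter_subproof j).

(* s(i, p) = a_i a_(i+1) ... a_(i+p-1).                                       *)
Definition circ_word (i : int) (p : nat) : seq 'I_m :=
  [seq letter (i + k%:Z)%R | k <- iota 0 p].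

Definition circ_rel (l : nat) (u v : word 'I_m) : Prop :=
  exists i : 'I_m,
    u = posword (circ_word i%:Z l) /\ v = posword (circ_word (i%:Z + 1)%R l).

Definition circular_group (l : nat) : groupType := pres_group (circ_rel l).

Definition circ_elt (l : nat) (i : int) (p : nat) : circular_group l :=
  pres_class (circ_rel l) (posword (circ_word i p)).

Definition garside (l : nat) : circular_group l := circ_elt l 0%R l.

End CircularGroup.

(* Main.v *)
From HB Require Import structures.
Require Import Defs.
From mathcomp Require Import all_boot all_order all_algebra.
From mathcomp Require Import classical_sets cardinality.
From mathcomp Require Import ring zify.

(** Why the theorem is true.  Write D for the Garside element and s(i, p) for
    the product of p consecutive letters starting at a_i.  Since
    a_i s(i+1, l) = s(i, l) a_(i+l), one has a_i D = D a_(i+l) ([gen_garside]):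
    conjugation by D shifts the indices by l.  Hence D^k is central as soon as m
    divides k l, that is, as soon as m / gcd(m, l) divides k
    ([zgarside_central]).

    The converse rests on a normal form.  Every element is written uniquely as
    D^k s(i_1, p_1) ... s(i_r, p_r) with k an integer, 0 < p_j < l, and i_(j+1)
    different from i_j + p_j modulo m, so that no two neighbouring runs merge.
    Uniqueness comes from letting the group act on the set of all such normal
    forms: left multiplication by a_i or its inverse only lengthens, shortens,
    creates or deletes the first run ([gen_act], [inv_act]), and the defining
    relations hold because s(i, l) acts as k |-> k + 1 for every i
    ([act_full_run], [act_pres_eq]).  The evaluation of normal forms in the
    group intertwines this action with left multiplication ([value_act]), so an
    element is recovered from the image of the empty normal form
    ([value_eact]).

    Let z be central with normal form D^k w and w nonempty.  For 0 < q < l and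
    i different from the index that would continue the last run of w, the normal
    form of z s(i, q) is D^k w s(i, q).  Since it is also that of s(i, q) z and
    is longer than w, the run s(i, q) cannot have merged into w from the left,
    and the first run of w must be s(i + k l, q) ([central_first_syllable]).
    There are (m - 1)(l - 1) choices of (i, q), each forcing another first run;
    if m, l > 1 are not both 2, this is a contradiction.  So z = D^k
    ([central_zgarside]), and commutation with a_0 gives m | k l.

    In the abelian cases the group is generated by one letter, or by two
    commuting letters, and integer powers of these letters invert the obvious
    map to Z or Z^2 ([pres_isomorphic]). *)

Set Implicit Arguments.
Unset Strict Implicit.
Unset Printing Implicit Defensive.

Import GRing.Theory.

Local Open Scope ring_scope.
Local Open Scope group_scope.

(** * Integer powers and presented groups *)

(** Equivalences [P k <-> P (k + 1)] give induction in both directions at once: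
    identities in a group that propagate upwards propagate downwards by
    cancellation. *)
Lemma int_shift_ind (P : int -> Prop) :
  P 0%R -> (forall k, P k <-> P (k + 1)%R) -> forall k, P k.
Proof.
move=> P0 PS; elim=> // n Pn.
  by rewrite -addn1 PoszD; apply/(PS n%:Z).
by apply/PS; rewrite -addn1 PoszD opprD subrK.
Qed.

Section IntegerPowers.
Variable G : groupType.
Implicit Types (g h : G) (k : int).

Definition zexp g k : G :=
  match k with Posz n => g ^+ n | Negz n => g ^- n.+1 end.

Lemma zexpS g k : zexp g (k + 1)%R = zexp g k * g.
Proof.
case: k => [n|[|n]]; first by rewrite -PoszD addn1 /= expgSr.
  by rewrite /= expg1 mulVg.
have -> : (Negz n.+1 + 1 = Negz n)%R by lia.
by rewrite /= [g ^+ n.+2]expgS invgM mulgVK.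
Qed.

Lemma zexpD g j k : zexp g (j + k)%R = zexp g j * zexp g k.
Proof.
elim/int_shift_ind: k => [|k]; first by rewrite addr0 mulg1.
rewrite addrA !zexpS mulgA; split=> [->//|]; exact: mulIg.
Qed.

Lemma zexp_commute g h k : commute g h -> commute (zexp g k) h.
Proof.
move=> gh; apply: commute_sym; have hg n : commute h (g ^+ n).
  exact/commuteX/commute_sym.
by case: k => n; [exact: hg | exact/commuteV/hg].
Qed.

End IntegerPowers.

Lemma gmulf_zexp (G H : groupType) (f : UMagmaMorphism.type G H) g k :
  f (zexp g k) = zexp (f g) k.
Proof. by case: k => n; rewrite /= ?gmulfXVn ?gmulfXn. Qed.

Lemma zexp_Z (k j : int) : zexp (k : Zgroup) j = (k * j)%R.
Proof.
elim/int_shift_ind: j => [|j]; first by rewrite mulr0.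
rewrite zexpS mulrDr mulr1; split=> [->//|]; exact: mulIg.
Qed.

Section PresentedGroups.
Variables (S : choiceType) (R : word S -> word S -> Prop).
Local Notation G := (pres_group R).

Lemma pres_group_ind (P : G -> Prop) :
  P 1 -> (forall x g, P g -> P (pres_gen R x * g)) ->
  (forall x g, P g -> P ((pres_gen R x)^-1 * g)) -> forall g, P g.
Proof.
move=> P1 Pg PV g; rewrite -(pres_classK g).
elim: (repr g) => [|[x b] u IHu] //.
rewrite -cat1s pres_class_cat; case: b; first exact: Pg.
by rewrite -[[:: _]]/(word_inv [:: (x, true)]) pres_classV; apply: PV.
Qed.

Lemma pres_group_central (z : G) :
  (forall x, commute z (pres_gen R x)) -> forall g, commute z g.
Proof.
move=> zx; elim/pres_group_ind=> [|x g zg|x g zg]; first exact: commute1.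
  exact: commuteM.
by apply: commuteM zg; apply: commuteV.
Qed.

Lemma word_eval_pos (H : groupType) (f : S -> H) (s : seq S) :
  word_eval f (posword s) = \prod_(x <- s) f x.
Proof. by rewrite /word_eval big_map. Qed.

(** The map to [H] comes from the universal property of the presentation; it is
    enough to have a morphism [s] back that sends [f x] to the generator [x],
    because [s] is then automatically a left inverse. *)
Lemma pres_isomorphic (H : groupType) (f : S -> H) (s : H -> G) :
  (forall u v, R u v -> word_eval f u = word_eval f v) ->
  {morph s : x y / x * y} -> (forall x, s (f x) = pres_gen R x) ->
  (forall F : UMagmaMorphism.type G H,
     (forall x, F (pres_gen R x) = f x) -> cancel s F) ->
  isomorphic G H.
Proof.
move=> fR sM sf sF; have [F0 [[F0M F0f] _]] := pres_universal fR.
pose Fmix := isMultiplicative.Build G H F0 F0M.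
pose F1mix := Multiplicative_isUMagmaMorphism.Build G H F0.
have F01 : F0 1 = 1 by apply: (mulIg (F0 1)); rewrite -F0M !mul1g.
pose F : UMagmaMorphism.type G H := HB.pack F0 Fmix (F1mix F01).
have FK := sF F F0f.
have s1 : s 1 = 1 by apply: (mulIg (s 1)); rewrite -sM !mul1g.
have sV x : s x^-1 = (s x)^-1 by apply: (mulIg (s x)); rewrite -sM !mulVg.
have F0V x : F0 x^-1 = (F0 x)^-1.
  by apply: (mulIg (F0 x)); rewrite -F0M !mulVg.
exists F; exists s => // g; rewrite -[_ (F : {multiplicative _ -> _}) g]/(F0 g).
elim/pres_group_ind: g => [|x g IHg|x g IHg]; first by rewrite F01 s1.
  by rewrite F0M sM IHg F0f sf.
by rewrite F0M F0V sM sV IHg F0f sf.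
Qed.

End PresentedGroups.

Lemma isomorphic_abelian (G H : groupType) :
  isomorphic G H -> is_abelian H -> is_abelian G.
Proof.
case=> f /bij_inj fI abH x y; apply: fI; rewrite !gmulfM; exact: abH.
Qed.

(** * Indices modulo m *)

Section Letters.
Local Open Scope ring_scope.
Variables (m : nat) (hm : (0 < m)%N).
Local Notation L := (letter hm).

Lemma letter_eq (i j : int) : (L i == L j) = (i == j %[mod m])%Z.
Proof.
rewrite -val_eqE /= -eqz_nat !gez0_abs ?modz_ge0 //; lia.
Qed.

Lemma letterK (x : 'I_m) : L x%:Z = x.
Proof. by apply/val_inj; rewrite /= modz_small // lez_nat ltz_nat ltn_ord. Qed.

Lemma letter_addl (i j : int) : L ((L i)%:Z + j) = L (i + j).
Proof.
apply/eqP; rewrite letter_eq /= gez0_abs ?modz_ge0 ?modzDml //; lia.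
Qed.

Lemma letter_add_eq (i j : int) : (L (i + j) == L i) = (m %| `|j|)%N.
Proof.
rewrite letter_eq -{2}[i]addr0 eqz_modDl mod0z.
by rewrite -(sameP dvdz_mod0P eqP) dvdzE.
Qed.

Lemma circ_wordS (i : int) p :
  circ_word hm i p.+1 = L i :: circ_word hm (i + 1) p.
Proof.
rewrite /circ_word /= addr0 (iotaDl 1 0) -map_comp; congr cons.
by apply: eq_map => k /=; rewrite PoszD addrA.
Qed.

Lemma circ_word_letter (i : int) p : circ_word hm (L i)%:Z p = circ_word hm i p.
Proof. by apply: eq_map => k; rewrite letter_addl. Qed.

End Letters.

(** * The action on normal forms *)

Section NormalForms.
Local Open Scope ring_scope.
Variables (m : nat) (hm : (0 < m)%N) (l : nat) (hl : (0 < l)%N).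
Local Notation L := (letter hm).

Definition syllable : Type := 'I_m * nat.
Implicit Types (x : 'I_m) (w t : seq syllable) (i k : int) (p q : nat).

(** The index that would continue the run [s]. *)
Definition after (s : syllable) : 'I_m := L (s.1%:Z + s.2%:Z).

Definition reduced w :=
  all (fun s : syllable => (0 < s.2 < l)%N) w
  && sorted (fun s s' => s'.1 != after s) w.

Definition starts x w := if w is s :: _ then s.1 == x else false.

(** Allowing an empty run [p = 0] in front of [w] removes most case
    distinctions: for every [x], each normal form is uniquely [scons x p t] with
    [fits x p t], where [p] may vanish. *)
Definition scons x p w : seq syllable := if p == 0%N then w else (x, p) :: w.

Definition lead x w :=
  if w is s :: _ then if s.1 == x then s.2 else 0%N else 0%N.

Definition rest x w := if starts x w then behead w else w.

Definition fits x p t := [&& (p < l)%N, reduced t & ~~ starts (after (x, p)) t].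

Lemma after_letter i p : after (L i, p) = L (i + p%:Z).
Proof. exact: letter_addl. Qed.

Lemma after0 x : after (x, 0%N) = x.
Proof. by rewrite /after /= addr0 letterK. Qed.

Lemma reduced_cons x p t :
  reduced ((x, p) :: t) = (0 < p)%N && fits x p t.
Proof.
rewrite /fits /reduced /=; case: t => [|s t] /=; first by rewrite !andbT.
case: (0 < p)%N; case: (p < l)%N; rewrite ?andbF //= andbC -!andbA.
by do !bool_congr.
Qed.

Lemma reduced_scons x p t : fits x p t -> reduced (scons x p t).
Proof.
rewrite /scons; case: eqP => [_ /and3P[]//|/eqP p0 xpt].
by rewrite reduced_cons lt0n p0.
Qed.

Lemma scons_split x w :
  reduced w -> exists p t, fits x p t /\ w = scons x p t.
Proof.
case: w => [|[y p] t] rw; first by exists 0%N, [::]; rewrite /fits hl.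
have [->|yx] := eqVneq x y.
  move: rw; rewrite reduced_cons => /andP[p0 yt].
  by exists p, t; split=> //; rewrite /scons gtn_eqF.
exists 0%N, ((y, p) :: t); split=> //.
by rewrite /fits hl rw after0 /= eq_sym.
Qed.

Lemma lead_scons x p t : fits x p t -> lead x (scons x p t) = p.
Proof.
rewrite /scons; case: eqP => [-> /and3P[_ _]|_ _]; last by rewrite /= eqxx.
by rewrite after0; case: t => //= s t /negbTE->.
Qed.

Lemma rest_scons x p t : fits x p t -> rest x (scons x p t) = t.
Proof.
rewrite /scons /rest; case: eqP => [-> /and3P[_ _]|_ _].
  by rewrite after0 => /negbTE->.
by rewrite /= eqxx.
Qed.

(** A state [(k, w)] stands for D^k w.  Moving the letter a_i to the right of
    D^k turns its index into j = i + k l; there it extends a run starting at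
    j + 1, which becomes a new factor D once its length is l. *)
Definition gen_act x (st : int * seq syllable) :=
  let: (k, w) := st in
  let j := x%:Z + k * l%:Z in
  let p := (lead (L (j + 1)) w).+1 in
  let t := rest (L (j + 1)) w in
  if p == l then (k + 1, t) else (k, scons (L j) p t).

(** If no run starts at j, then a_j^-1 = s(j+1, l-1) D^-1 = D^-1 s(j+1-l, l-1)
    is used instead of removing the first letter of a run. *)
Definition inv_act x (st : int * seq syllable) :=
  let: (k, w) := st in
  let j := x%:Z + k * l%:Z in
  let p := lead (L j) w in
  let t := rest (L j) w in
  if p == 0%N then (k - 1, scons (L (j + 1 - l%:Z)) l.-1 t)
  else (k, scons (L (j + 1)) p.-1 t).

Definition act (u : word 'I_m) (st : int * seq syllable) :=
  foldr (fun s : 'I_m * bool => if s.2 then gen_act s.1 else inv_act s.1) st u.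

Lemma act_cat u v st : act (u ++ v) st = act u (act v st).
Proof. exact: foldr_cat. Qed.

Lemma gen_actE i k p t : fits (L (i + k * l%:Z + 1)) p t ->
  gen_act (L i) (k, scons (L (i + k * l%:Z + 1)) p t) =
  if p.+1 == l then (k + 1, t) else (k, scons (L (i + k * l%:Z)) p.+1 t).
Proof.
move=> f; rewrite /gen_act letter_addl -addrA letter_addl addrA.
by rewrite lead_scons // rest_scons.
Qed.

Lemma inv_actE i k p t : fits (L (i + k * l%:Z)) p t ->
  inv_act (L i) (k, scons (L (i + k * l%:Z)) p t) =
  if p == 0%N then (k - 1, scons (L (i + k * l%:Z + 1 - l%:Z)) l.-1 t)
  else (k, scons (L (i + k * l%:Z + 1)) p.-1 t).
Proof.
move=> f; rewrite /inv_act letter_addl lead_scons // rest_scons //.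
by rewrite -!addrA !letter_addl !addrA.
Qed.

Lemma fits_letter i p t :
  fits (L i) p t = [&& (p < l)%N, reduced t & ~~ starts (L (i + p%:Z)) t].
Proof. by rewrite /fits after_letter. Qed.

Lemma gen_act_reduced x st : reduced st.2 -> reduced (gen_act x st).2.
Proof.
case: st => k w; rewrite -[x](letterK hm) [X in reduced X -> _]/= => rw.
have [p [t [f ->]]] := scons_split (L (x%:Z + k * l%:Z + 1)) rw.
rewrite gen_actE //; move: f; rewrite fits_letter => /and3P[pl rt st].
case: eqP => //= /eqP p1; apply: reduced_scons.
rewrite fits_letter rt intS addrA st; lia.
Qed.

Lemma inv_actK x st : reduced st.2 ->
  reduced (inv_act x st).2 /\ gen_act x (inv_act x st) = st.
Proof.
case: st => k w; rewrite -[x](letterK hm) [X in reduced X -> _]/= => rw.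
have [p [t [f ->]]] := scons_split (L (x%:Z + k * l%:Z)) rw.
rewrite inv_actE //; move: f; rewrite fits_letter => /and3P[pl rt st].
case: eqP => [p0|/eqP p0].
  have -> : x%:Z + k * l%:Z + 1 - l%:Z = x%:Z + (k - 1) * l%:Z + 1 by ring.
  have f : fits (L (x%:Z + (k - 1) * l%:Z + 1)) l.-1 t.
    rewrite fits_letter rt.
    have -> : x%:Z + (k - 1) * l%:Z + 1 + l.-1%:Z = x%:Z + k * l%:Z + p%:Z.
      by lia.
    by rewrite st; lia.
  split; first exact: reduced_scons.
  by rewrite gen_actE // prednK // eqxx p0 subrK.
have f : fits (L (x%:Z + k * l%:Z + 1)) p.-1 t.
  by rewrite fits_letter rt -addrA -intS prednK ?lt0n // st; lia.
split; first exact: reduced_scons.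
by rewrite gen_actE // prednK ?lt0n // ltn_eqF.
Qed.

Lemma gen_actK x st : reduced st.2 -> inv_act x (gen_act x st) = st.
Proof.
case: st => k w; rewrite -[x](letterK hm) [X in reduced X -> _]/= => rw.
have [p [t [f ->]]] := scons_split (L (x%:Z + k * l%:Z + 1)) rw.
rewrite gen_actE //; move: f; rewrite fits_letter => /and3P[pl rt st].
case: eqP => [p1|/eqP p1].
  rewrite -{1}[t]/(scons (L (x%:Z + (k + 1) * l%:Z)) 0 t) inv_actE /=.
    by rewrite addrK -p1 /=; congr (_, scons (L _) _ _); lia.
  rewrite fits_letter rt hl.
  by have -> : x%:Z + (k + 1) * l%:Z + 0 = x%:Z + k * l%:Z + 1 + p%:Z by lia.
by rewrite inv_actE // fits_letter rt intS addrA st; lia.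
Qed.

Lemma act_reduced u st : reduced st.2 -> reduced (act u st).2.
Proof.
move=> rst; elim: u => [|[x []] u IHu] //=; first exact: gen_act_reduced.
by case: (inv_actK x IHu).
Qed.

(** The new run extends the first run of the normal form to length [p + q], and
    a factor D splits off when this reaches [l].  In that case the remaining
    letters act after the passage from [k] to [k + 1], which accounts for the
    shift of the index. *)
Lemma act_run i k q p t :
  (q <= l)%N -> fits (L (i + k * l%:Z + q%:Z)) p t ->
  act (posword (circ_word hm i q)) (k, scons (L (i + k * l%:Z + q%:Z)) p t) =
  if (p + q < l)%N then (k, scons (L (i + k * l%:Z)) (p + q) t)
  else (k + 1, scons (L (i + (k + 1) * l%:Z)) (p + q - l) t).
Proof.
elim: q i => [|q IHq] i ql.
  by rewrite /= addr0 addn0 => /and3P[-> ].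
rewrite circ_wordS /= intS.
have -> : i + k * l%:Z + (1 + q%:Z) = (i + 1) + k * l%:Z + q%:Z by ring.
move=> f; rewrite IHq ?(ltnW ql) //.
move: f; rewrite fits_letter => /and3P[pl rt st].
have -> : (i + 1) + k * l%:Z = i + k * l%:Z + 1 by ring.
have -> : (i + 1) + (k + 1) * l%:Z = i + (k + 1) * l%:Z + 1 by ring.
case: ltnP => pq; rewrite gen_actE.
- case: eqP => pq1; last by rewrite addnS ifT //; lia.
  by rewrite ifF; [have -> : (p + q.+1 - l = 0)%N by lia | lia].
- rewrite fits_letter rt pq.
  have -> // : i + k * l%:Z + 1 + (p + q)%:Z = i + 1 + k * l%:Z + q%:Z + p%:Z.
  by lia.
- rewrite !ifF; [|lia|lia].
  by have -> : (p + q.+1 - l = (p + q - l).+1)%N by lia.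
- rewrite fits_letter rt.
  have -> : i + (k + 1) * l%:Z + 1 + (p + q - l)%N%:Z =
            i + 1 + k * l%:Z + q%:Z + p%:Z by lia.
  by rewrite st; lia.
Qed.

(** With [q = l] in [act_run] a factor D always splits off, and the run that is
    left is the original one; the result does not depend on [i]. *)
Lemma act_full_run i k w : reduced w ->
  act (posword (circ_word hm i l)) (k, w) = (k + 1, w).
Proof.
move=> rw; have [p [t [f ->]]] := scons_split (L (i + k * l%:Z + l%:Z)) rw.
rewrite act_run // addnK ifF; last by lia.
by have -> : i + (k + 1) * l%:Z = i + k * l%:Z + l%:Z by ring.
Qed.

(** This is the action of the group on normal forms.  Cancellation holds only on
    reduced lists, which is why words act on all lists but the invariance is
    restricted. *)
Lemma act_pres_eq u v st :
  pres_eq (circ_rel hm l) u v -> reduced st.2 -> act u st = act v st.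
Proof.
move=> uv; elim: uv st => {u v}.
- move=> _ _ [i [-> ->]] [k w] rw; by rewrite !act_full_run.
- by move=> x [] st rst /=; [case: (inv_actK x rst) | exact: gen_actK].
- by [].
- by move=> u v _ IH st rst; rewrite IH.
- by move=> u v w _ IH _ IH' st rst; rewrite IH // IH'.
- move=> u u' v v' _ IHu _ IHv st rst.
  by rewrite !act_cat IHv // IHu // act_reduced.
Qed.

End NormalForms.

(** * Runs of letters and the Garside element *)

Section Elements.
Variables (m : nat) (hm : (0 < m)%N) (l : nat).
Local Notation L := (letter hm).
Local Notation G := (circular_group hm l).
Local Notation gen := (pres_gen (circ_rel hm l)).
Local Notation D := (garside hm l).
Local Notation run := (circ_elt hm l).

Lemma run0 i : run i 0 = 1.
Proof. by []. Qed.

Lemma runS i p : run i p.+1 = gen (L i) * run (i + 1)%R p.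
Proof. by rewrite /circ_elt circ_wordS -pres_class_cat. Qed.

Lemma run1 i : run i 1 = gen (L i).
Proof. by rewrite runS run0 mulg1. Qed.

Lemma run_letter i p : run (L i)%:Z p = run i p.
Proof. by rewrite /circ_elt circ_word_letter. Qed.

Lemma runD i p q : run i (p + q) = run i p * run (i + p%:Z)%R q.
Proof.
elim: p i => [|p IHp] i; first by rewrite addr0 mul1g.
by rewrite addSn !runS IHp mulgA -addrA -intS.
Qed.

(** The relations give this for consecutive indices in {0, ..., m-1}; both sides
    are periodic in the index, so it propagates to all integers. *)
Lemma run_garside i : run i l = D.
Proof.
elim/int_shift_ind: i => // i; suff -> : run i l = run (i + 1)%R l by [].
rewrite -(run_letter i); apply/pres_classP/PresRel; exists (L i); split=> //.
rewrite -(circ_word_letter _ (i + 1)%R) -(circ_word_letter _ (_ + 1)%R).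
by rewrite letter_addl.
Qed.

(** Both sides are the run of length l + 1 starting at i. *)
Lemma gen_garside i : gen (L i) * D = D * gen (L (i + l%:Z)%R).
Proof.
rewrite -{1}(run_garside (i + 1)%R) -(run_garside i) -runS.
by rewrite -addn1 runD /= runS run0 mulg1.
Qed.

Lemma gen_zgarside i k :
  gen (L i) * zexp D k = zexp D k * gen (L (i + k * l%:Z)%R).
Proof.
elim/int_shift_ind: k i => [|k].
 by move=> i; rewrite mul0r addr0 mulg1 mul1g.
have E i : (i + (k + 1) * l%:Z)%R = (i + k * l%:Z + l%:Z)%R by ring.
split=> IH i; first by rewrite zexpS mulgA IH E -!mulgA gen_garside.
apply: (mulIg D); rewrite -!mulgA gen_garside -E -zexpS !mulgA -zexpS.
exact: IH.
Qed.

Lemma zgarside_central k :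
  (m %| `|k| * l)%N -> forall g : G, commute (zexp D k) g.
Proof.
move=> mkl; apply: pres_group_central => x; rewrite /commute -(letterK hm x).
rewrite gen_zgarside; congr (_ * gen _); apply/esym/eqP.
by rewrite letter_add_eq abszM.
Qed.

End Elements.

(** * The abelian cases *)

Section Cyclic.
Variables (m : nat) (hm : (0 < m)%N) (l : nat).
Local Notation gen := (pres_gen (circ_rel hm l)).

Lemma one_generator_Z :
  (forall x y, gen x = gen y) -> isomorphic (circular_group hm l) Zgroup.
Proof.
move=> genE; pose a := gen (letter hm 0).
apply: (@pres_isomorphic _ _ Zgroup (fun=> 1%R : Zgroup) (zexp a)).
- move=> _ _ [i [-> ->]]; rewrite !word_eval_pos.
  by rewrite !big_map.
- by move=> j k; rewrite -zexpD.
- by move=> x; rewrite /= expg1; apply: genE.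
- by move=> F Fg k; rewrite gmulf_zexp Fg zexp_Z mul1r.
Qed.

Lemma circular_1_Z :
  m = 1%N \/ l = 1%N -> isomorphic (circular_group hm l) Zgroup.
Proof.
move=> ml; apply: one_generator_Z => x y.
case: ml => [m1|l1].
  by congr gen; apply/val_inj; case: x y => x lx [y ly] /=; lia.
have E z : gen z = garside hm l.
  rewrite -(run_garside hm l z%:Z) -[z in gen z](letterK hm) -run1.
  by congr (circ_elt hm l _ _); rewrite l1.
by rewrite !E.
Qed.

Lemma circular_22_Z2 :
  m = 2%N -> l = 2%N -> isomorphic (circular_group hm l) Z2group.
Proof.
move=> m2 l2; pose a := gen (letter hm 0); pose b := gen (letter hm 1).
have ab : commute a b.
  have run2 i : garside hm l = gen (letter hm i) * gen (letter hm (i + 1)).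
    rewrite -(run_garside hm l i) -(run1 _ _ (i + 1)) -runS.
    by congr (circ_elt hm l _ _).
  rewrite /commute -[LHS](run2 0%R) (run2 1%R); congr (_ * gen _).
  by apply/eqP; rewrite letter_eq m2.
pose f x : Z2group := if x == letter hm 0 then (1, 0)%R else (0, 1)%R.
have two (x : 'I_m) : x = letter hm 0 \/ x = letter hm 1.
  case: x => [[|[|x]] lx]; [left | right | lia].
    by apply/val_inj; rewrite /= m2.
  by apply/val_inj; rewrite /= m2.
have f0 : f (letter hm 0) = (1, 0)%R by rewrite /f eqxx.
have f1 : f (letter hm 1) = (0, 1)%R by rewrite /f letter_eq m2.
apply: (@pres_isomorphic _ (circ_rel hm l) Z2group f
  (fun k : int * int => zexp a k.1 * zexp b k.2)).
- move=> _ _ [i [-> ->]]; rewrite !word_eval_pos.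
  have Es j : circ_word hm j l = [:: letter hm j; letter hm (j + 1)].
    by rewrite l2 !circ_wordS.
  rewrite !Es !big_cons !big_nil -addrA; apply/eqP.
  have -> : letter hm (i%:Z + (1 + 1)) = letter hm i%:Z.
    by apply/eqP; rewrite letter_add_eq m2.
  by rewrite !mulg1; apply/eqP/Algebra.commuteT.
- move=> j k /=; rewrite !zexpD -!mulgA; congr (_ * _); rewrite !mulgA.
  by congr (_ * _); apply/commute_sym/zexp_commute/commute_sym/zexp_commute.
- move=> x; case: (two x) => ->; rewrite ?f0 ?f1 /= ?expg1 ?mulg1 ?mul1g //.
- move=> F Fg [j k] /=; rewrite gmulfM !gmulf_zexp !Fg f0 f1.
  have zexpE (g : Z2group) h : zexp g h = (g.1 * h, g.2 * h)%R.
    elim/int_shift_ind: h => [|h]; first by rewrite !mulr0.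
    have E : (g.1 * (h + 1), g.2 * (h + 1))%R =
             ((g.1 * h, g.2 * h)%R : Z2group) * g.
      by rewrite !mulrDr !mulr1.
    rewrite zexpS E; split=> [->//|]; exact: mulIg.
  rewrite !zexpE; congr pair => /=; ring.
Qed.

End Cyclic.

(** * The center *)

Section Center.
Variables (m : nat) (hm : (0 < m)%N) (l : nat) (hl : (0 < l)%N).
Local Notation L := (letter hm).
Local Notation G := (circular_group hm l).
Local Notation gen := (pres_gen (circ_rel hm l)).
Local Notation D := (garside hm l).
Local Notation run := (circ_elt hm l).
Local Notation state := (int * seq (syllable m))%type.
Implicit Types (w t : seq (syllable m)) (st : state) (k i : int).
Local Notation reduced := (reduced hm l).

Definition eact (g : G) st : state := act hm l (repr g) st.

Lemma eact_class u st : reduced st.2 ->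
  eact (pres_class (circ_rel hm l) u) st = act hm l u st.
Proof. by move=> rst; apply: act_pres_eq rst => //; apply: pres_eq_repr. Qed.

Lemma eact_reduced g st : reduced st.2 -> reduced (eact g st).2.
Proof. exact: act_reduced. Qed.

Lemma eactM g h st : reduced st.2 -> eact (g * h) st = eact g (eact h st).
Proof.
move=> rst; rewrite -{1}(pres_classK g) -{1}(pres_classK h) -pres_class_cat.
by rewrite eact_class // act_cat.
Qed.

Lemma eact1 st : reduced st.2 -> eact 1 st = st.
Proof. by move=> rst; rewrite -pres_class_nil eact_class. Qed.

Lemma eact_zgarside k j w : reduced w -> eact (zexp D k) (j, w) = (j + k, w)%R.
Proof.
move=> rw; have eactD i : eact D (i, w) = (i + 1, w)%R.
  by rewrite eact_class // act_full_run.
elim/int_shift_ind: k j => [|k].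
  by move=> j; rewrite eact1 // addr0.
split=> IH j; first by rewrite zexpS eactM // eactD IH -addrA [(1 + k)%R]addrC.
have := IH (j - 1)%R; rewrite zexpS eactM // eactD subrK => ->.
by congr (_, _); ring.
Qed.

Definition value st : G := zexp D st.1 * \prod_(s <- st.2) run s.1 s.2.

Lemma value_scons k i p t : 
  value (k, scons (L i) p t) = zexp D k * run i p * \prod_(s <- t) run s.1 s.2.
Proof.
rewrite /value /scons /=; case: eqP => [->|_]; first by rewrite run0 mulg1.
by rewrite big_cons run_letter mulgA.
Qed.

(** The two cases of [gen_act] are the identities a_j s(j+1, p) = s(j, p+1) and
    s(j, l) = D, after a_i has been moved past D^k. *)
Lemma value_gen_act x st : reduced st.2 ->
  value (gen_act hm l x st) = gen x * value st.
Proof.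
case: st => k w; rewrite -[x](letterK hm) [X in reduced X -> _]/= => rw.
have [p [t [f ->]]] := scons_split hl (L (x%:Z + k * l%:Z + 1)) rw.
rewrite gen_actE // value_scons !mulgA gen_zgarside -(mulgA (zexp D k)) -runS.
case: eqP => [->|_]; last exact: value_scons.
by rewrite run_garside -zexpS.
Qed.

Lemma value_act u st : reduced st.2 ->
  value (act hm l u st) = pres_class (circ_rel hm l) u * value st.
Proof.
move=> rst; elim: u => [|[x b] u IHu]; first by rewrite mul1g.
have ru := act_reduced hl u rst.
rewrite -cat1s pres_class_cat -mulgA -IHu; case: b => /=.
  exact: value_gen_act.
rewrite -[[:: _]]/(word_inv [:: (x, true)]) pres_classV; apply: (mulgI (gen x)).
have [rx xK] := inv_actK hl x ru.
by rewrite -value_gen_act // xK mulVKg.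
Qed.

(** The empty normal form has value 1.  Hence the action is faithful, and an
    element that sends the empty normal form to [(k, [::])] is D^k. *)
Lemma value_eact g : value (eact g (0%R, [::])) = g.
Proof. by rewrite value_act // pres_classK /value big_nil !mulg1. Qed.

Lemma eact_run k i p q t : (p <= l)%N ->
  fits hm l (L (i + k * l%:Z + p%:Z)) q t ->
  eact (run i p) (k, scons (L (i + k * l%:Z + p%:Z)) q t) =
  if (q + p < l)%N then (k, scons (L (i + k * l%:Z)) (q + p) t)
  else (k + 1, scons (L (i + (k + 1) * l%:Z)) (q + p - l) t)%R.
Proof.
by move=> pl f; rewrite eact_class; [exact: act_run | exact: reduced_scons].
Qed.

Lemma eact_syllable x p t : reduced ((x, p) :: t) ->
  eact (run x%:Z p) (0%R, t) = (0%R, (x, p) :: t).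
Proof.
rewrite reduced_cons => /andP[p0 f]; have /and3P[pl rt st] := f.
have := @eact_run 0%R x p 0%N t (ltnW pl).
rewrite mul0r addr0 add0n pl letterK /scons /= gtn_eqF // => -> //.
by rewrite /fits rt hl after0.
Qed.

(** The value of a normal form acts by concatenation whenever no merging
    occurs. *)
Lemma eact_value k w t : reduced (w ++ t) ->
  eact (value (k, w)) (0%R, t) = (k, w ++ t).
Proof.
have suffix_reduced v1 v2 : reduced (v1 ++ v2) -> reduced v2.
  elim: v1 => // [[x p] v1 IH]; rewrite cat_cons reduced_cons => /andP[_].
  by case/and3P=> _ /IH.
move=> rwt; have rt := suffix_reduced _ _ rwt; rewrite /value eactM //=.
suff -> : eact (\prod_(s <- w) run s.1 s.2) (0%R, t) = (0%R, w ++ t).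
  by rewrite eact_zgarside // add0r.
elim: w rwt => [|[x p] w IHw] rwt; first by rewrite big_nil eact1.
rewrite big_cons eactM //= IHw; first exact: eact_syllable.
exact: (suffix_reduced [:: (x, p)]).
Qed.

(** Compare the normal forms of [z * run i q] and [run i q * z].  The first is
    that of [z] with one more run at the end.  In the second, either a run is
    put in front, or it merges and the number of runs does not grow; by length,
    only the former is possible. *)
Lemma central_first_syllable z x p t i q :
  (forall g, commute z g) -> (eact z (0%R, [::])).2 = (x, p) :: t ->
  (0 < q < l)%N -> L i != after hm (last (x, p) t) ->
  (x, p) = (L (i + (eact z (0%R, [::])).1 * l%:Z)%R, q).
Proof.
move=> zC; case Ez: (eact z _) => [k w] /= Ew ql ie.
have rw : reduced w by rewrite -[w]/((k, w).2) -Ez eact_reduced.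
have zE : z = value (k, w) by rewrite -Ez value_eact.
have rwi : reduced (w ++ [:: (L i, q)]).
  move: rw; rewrite Ew /reduced => /andP[aw sw]; rewrite all_cat aw /= ql.
  by rewrite cat_path [path _ _ t]sw /= ie.
have rq : reduced [:: (L i, q)] by rewrite /reduced /= ql.
have right : eact (z * run i q) (0%R, [::]) = (k, w ++ [:: (L i, q)]).
  by rewrite eactM // -run_letter eact_syllable // zE eact_value.
have := right; rewrite zC eactM // Ez.
have [r [v [f wE]]] := scons_split hl (L (i + k * l%:Z + q%:Z)) rw.
have ql' : (q <= l)%N by lia.
rewrite {1}wE eact_run // => E.
have : size (w ++ [:: (L i, q)]) = (size w).+1 by rewrite size_cat addn1.
(* r is the length of the run of w into which run i q merges. *)
case: (posnP r) wE E => [->|r0] wE E.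
  move: E; rewrite add0n ifT; last by lia.
  rewrite [scons _ q _]/scons gtn_eqF; last by lia.
  by rewrite Ew => -[-> ->].
have -> : size w = (size v).+1 by rewrite wE /scons gtn_eqF.
move: (congr1 snd E); case: ifP => _ /= <-; rewrite /scons.
  by case: eqP => _ /=; lia.
by case: eqP => _ /=; lia.
Qed.

(** If 2 < m, the runs of length 1 at two different indices force two different
    first indices; if 2 < l, runs of lengths 1 and 2 at the same index force two
    different first lengths. *)
Lemma central_zgarside z : (1 < m)%N -> (1 < l)%N -> (2 < m + l - 2)%N ->
  (forall g, commute z g) -> z = zexp D (eact z (0%R, [::])).1.
Proof.
move=> m1 l1 ml zC; rewrite -{1}(value_eact z); case Ez: (eact z _) => [k w].
case: w Ez => [|[x p] t] Ez; first by rewrite /value big_nil mulg1.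
have /= F i q := @central_first_syllable z x p t i q zC.
rewrite Ez /= in F.
set e := (last (x, p) t).1%:Z + (last (x, p) t).2%:Z.
have Le c : (0 < c < m)%N -> L (e + c%:Z) != after hm (last (x, p) t).
  by move=> cm; rewrite letter_add_eq gtnNdvd //; lia.
have E1 := F (e + 1)%R 1%N erefl l1 (Le 1%N m1).
have [m2|m2] := ltnP 2 m.
  have := F (e + 2)%R 1%N erefl l1 (Le 2 m2); rewrite E1.
  move=> /(congr1 fst) /esym /eqP /=.
  have -> : (e + 2 + k * l%:Z = e + 1 + k * l%:Z + 1)%R by ring.
  by rewrite letter_add_eq gtnNdvd.
have l2 : (1 < 2 < l)%N by lia.
by have := F (e + 1)%R 2 erefl l2 (Le 1%N m1); rewrite E1 => -[].
Qed.

Lemma zgarside_central_dvd k : (1 < l)%N ->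
  (forall g : G, commute (zexp D k) g) -> (m %| `|k| * l)%N.
Proof.
move=> l1 kC; have := kC (gen (L 0)); rewrite /commute gen_zgarside => /mulgI.
have gen_base x : eact (gen x) (0%R, [::]) = (0%R, [:: (x, 1%N)]).
  by rewrite -[x in gen x](letterK hm) -run1 eact_syllable // /reduced /= l1.
move=> /(congr1 (fun g => head (L 0) (map fst (eact g (0%R, [::])).2))).
by rewrite !gen_base /= => /esym/eqP; rewrite letter_add_eq abszM.
Qed.

Lemma center_circular : (1 < m)%N -> (1 < l)%N -> (2 < m + l - 2)%N ->
  infinite_cyclic_generated_by (group_center G) (D ^+ (m %/ gcdn m l)).
Proof.
move=> m1 l1 ml; set n := (m %/ gcdn m l)%N.
have g0 : (0 < gcdn m l)%N by rewrite gcdn_gt0 hm.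
have n0 : (0 < n)%N by rewrite divn_gt0 // dvdn_leq // dvdn_gcdl.
have dvdnE (k : nat) : (m %| k * l)%N = (n %| k)%N.
  rewrite dvdn_divLR ?dvdn_gcdl // muln_gcdr dvdn_gcd.
  by rewrite (dvdn_mull k (dvdnn m)).
have center_zexp k : group_center G (zexp D k) <-> (n %| `|k|)%N.
  rewrite -dvdnE; split; last exact: zgarside_central.
  exact: zgarside_central_dvd.
have centerE : group_center G = cyclic_subgroup (D ^+ n).
  apply/seteqP; split=> [z zC|z [c]].
    have zE := central_zgarside m1 l1 ml zC; move: zC; rewrite zE.
    set k := (eact z _).1; move/center_zexp/dvdnP=> [c kc].
    exists c; rewrite -expgnA mulnC -kc.
    by case: k {kc zE} => a /=; [left | right].
  rewrite -expgnA => -[->|->]; first exact/(center_zexp (n * c)%N%:Z)/dvdn_mulr.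
  have -> : D ^- (n * c) = zexp D (- (n * c)%N%:Z).
    by case: (n * c)%N => //=; rewrite invg1.
  by apply/center_zexp; rewrite abszN; apply/dvdn_mulr.
split=> //; rewrite centerE => fin; apply: infinite_nat.
(* The exponent of D, divided by n, maps the powers of D^n onto all of nat. *)
pose f (g : G) := (`|(eact g (0%R, [::])).1| %/ n)%N.
apply: sub_finite_set (finite_image f fin).
move=> c _; exists (D ^+ n ^+ c); first by exists c; left.
by rewrite /f -expgnA -/(zexp D (n * c)%N%:Z) eact_zgarside // add0r mulKn.
Qed.

End Center.

Theorem corollary2p11 (m l : nat) (hm : (0 < m)%N) (hl : (0 < l)%N) :
  [/\ m = 1%N \/ l = 1%N ->
        isomorphic (circular_group hm l) Zgroup /\
        is_abelian (circular_group hm l),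
      m = 2%N /\ l = 2%N ->
        isomorphic (circular_group hm l) Z2group /\
        is_abelian (circular_group hm l)
    & ~ (m = 1%N \/ l = 1%N) -> ~ (m = 2%N /\ l = 2%N) ->
        infinite_cyclic_generated_by (group_center (circular_group hm l))
          (garside hm l ^+ (m %/ gcdn m l))%g].
Proof.
split=> [ml1|[m2 l2]|ml1 ml2].
- have iso := circular_1_Z hm ml1; split=> //.
  by apply: isomorphic_abelian iso _ => x y; apply: Algebra.commuteT.
- have iso := circular_22_Z2 hm m2 l2; split=> //.
  by apply: isomorphic_abelian iso _ => x y; apply: Algebra.commuteT.
- by apply: center_circular => //; lia.
Qed.
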